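(* Let $X, Y \in \mathbb{C}^{n\times m}$, let $F \in \mathbb{C}^{n\times n}$ be the unitary matrix with entries $F_{j,k} = e^{2\pi i (j-1)(k-1)/n}/\sqrt{n}$, and let $\mathcal{X} = F^* X$, $\mathcal{Y} = F^* Y$, with $j$-th rows $\tilde{\mathcal{X}}_j, \tilde{\mathcal{Y}}_j \in \mathbb{C}^{1\times m}$. Then the circulant Procrustes problem $$\min\{\|Y - AX\|_F : A \in \mathbb{C}^{n\times n} \text{ circulant}\}$$ is solved by $A = F\,\mathrm{diag}(\hat a_1,\dots,\hat a_n)\,F^{*}$ with $$\hat a_j = \tilde{\mathcal{Y}}_j\,\tilde{\mathcal{X}}_j^{\dagger} \qquad (1 \le j \le n),$$ and $\tilde{\mathcal{Y}}_j\,\tilde{\mathcal{X}}_j^{\dagger} = \tilde{\mathcal{Y}}_j\tilde{\mathcal{X}}_j^{*}/\|\tilde{\mathcal{X}}_j\|_2^2$ whenever $\tilde{\mathcal{X}}_j \neq 0$.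
   Context: A matrix $A\in\mathbb{C}^{n\times n}$ is circulant if there are $a_0,\dots,a_{n-1}\in\mathbb{C}$ with $A_{j,k} = a_{(j-k) \bmod n}$ for all $j,k$. $\|\cdot\|_F$ is the Frobenius norm, $*$ denotes conjugate transpose, and $\dagger$ denotes the Moore--Penrose pseudoinverse. *)

(* Defs.v *)
From HB Require Import structures.
From mathcomp Require Import all_boot all_order all_algebra.
From mathcomp Require Import all_classical all_reals all_analysis.
From mathcomp Require Export complex.

Set Implicit Arguments.
Unset Strict Implicit.
Unset Printing Implicit Defensive.

Import Order.TTheory GRing.Theory Num.Theory.
Local Open Scope ring_scope.
Local Open Scope sesquilinear_scope.

(* [n - k] does not truncate since [k < n]; only the values [a 0 .. a (n - 1)]
   are used. *)
Definition circulant (T : Type) (n : nat) (A : 'M[T]_n) : Prop :=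
  exists a : nat -> T, forall j k : 'I_n, A j k = a ((j + (n - k)) %% n)%N.

Section Norms.
Variable C : numClosedFieldType.

(* The values are nonnegative reals of [C], on which the partial order of [C]
   is the usual order. *)
Definition frobenius_norm (m n : nat) (A : 'M[C]_(m, n)) : C :=
  sqrtC (\sum_(i < m) \sum_(j < n) `|A i j| ^+ 2).

Definition norm2 (n : nat) (v : 'rV[C]_n) : C :=
  sqrtC (\sum_(j < n) `|v 0 j| ^+ 2).

End Norms.

Section MoorePenrose.
Variable C : numClosedFieldType.
Implicit Types m n p : nat.

(* The four Penrose equations: [B] is the Moore-Penrose pseudoinverse of [A].
   The [pinvmx] of mxalgebra only satisfies the first one in general. *)
Definition is_mp_inverse m n (A : 'M[C]_(m, n)) (B : 'M[C]_(n, m)) : bool :=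
  [&& A *m B *m A == A,
      B *m A *m B == B,
      (A *m B)^t* == A *m B &
      (B *m A)^t* == B *m A].

Let adjM m n p (A : 'M[C]_(m, n)) (B : 'M[C]_(n, p)) :
  (A *m B)^t* = B^t* *m A^t*.
Proof. by rewrite trmx_mul map_mxM. Qed.

Let mul_adj_eq0 m n (A : 'M[C]_(m, n)) : A *m A^t* = 0 -> A = 0.
Proof.
move=> A0; apply/matrixP => i j; rewrite mxE.
have /matrixP/(_ i i) := A0; rewrite !mxE => /eqP.
rewrite psumr_eq0 => [/allP/(_ j)|k _]; last by rewrite !mxE mul_conjC_ge0.
by rewrite mem_index_enum !mxE mul_conjC_eq0 => /(_ isT)/eqP.
Qed.

Let row_free_gram m n (A : 'M[C]_(m, n)) :
  row_free A -> A *m A^t* \in unitmx.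
Proof.
move=> fA; rewrite -row_free_unit -kermx_eq0; apply/eqP.
apply: (row_free_inj fA); rewrite mul0mx; apply: mul_adj_eq0.
by rewrite adjM mulmxA -(mulmxA (kermx _)) mulmx_ker mul0mx.
Qed.

(* For a full-rank factorization A = L U,
   A^+ = U^* (U U^* )^-1 (L^* L)^-1 L^*. *)
Lemma mp_inverse_full_rank m r n (L : 'M[C]_(m, r)) (U : 'M[C]_(r, n)) :
  row_full L -> row_free U ->
  is_mp_inverse (L *m U)
    (U^t* *m invmx (U *m U^t*) *m invmx (L^t* *m L) *m L^t*).
Proof.
move=> fL fU.
have UU : U *m U^t* \in unitmx by exact: row_free_gram.
have LL : L^t* *m L \in unitmx.
  have := @row_free_gram _ _ (L^t*); rewrite trmxCK; apply.
  by rewrite /row_free mxrank_map mxrank_tr.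
set P := invmx (U *m U^t*); set Q := invmx (L^t* *m L).
have PH : P^t* = P by rewrite /P trmx_inv map_invmx adjM trmxCK.
have QH : Q^t* = Q by rewrite /Q trmx_inv map_invmx adjM trmxCK.
set B := U^t* *m P *m Q *m L^t*.
have AB : L *m U *m B = L *m Q *m L^t*.
  rewrite /B !mulmxA -(mulmxA L U) -(mulmxA L (U *m _)).
  by rewrite mulmxV // mulmx1.
have BA : B *m (L *m U) = U^t* *m P *m U.
  rewrite /B !mulmxA -(mulmxA _ (L^t*) L) -(mulmxA _ Q).
  by rewrite mulVmx // mulmx1.
apply/and4P; split; apply/eqP.
- rewrite AB !mulmxA -(mulmxA _ (L^t*) L) -(mulmxA L Q).
  by rewrite mulVmx // mulmx1.
- rewrite BA /B !mulmxA -(mulmxA _ U (U^t*)) -(mulmxA _ P (U *m _)).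
  by rewrite mulVmx // mulmx1.
- by rewrite AB !adjM trmxCK QH mulmxA.
- by rewrite BA !adjM trmxCK PH mulmxA.
Qed.

Lemma mp_inverse_exists m n (A : 'M[C]_(m, n)) :
  exists B : 'M[C]_(n, m), is_mp_inverse A B.
Proof.
have := mp_inverse_full_rank (col_base_full A) (row_base_free A).
by rewrite mulmx_base => h; eexists; exact: h.
Qed.

Definition mp_pinv m n (A : 'M[C]_(m, n)) : 'M[C]_(n, m) :=
  xchoose (mp_inverse_exists A).

Lemma mp_pinvP m n (A : 'M[C]_(m, n)) : is_mp_inverse A (mp_pinv A).
Proof. exact: xchooseP. Qed.

Lemma mp_inverse_unique m n (A : 'M[C]_(m, n)) (B : 'M[C]_(n, m)) :
  is_mp_inverse A B -> B = mp_pinv A.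
Proof.
have := mp_pinvP A; move: (mp_pinv A) => D.
move=> /and4P[/eqP d1 /eqP d2 /eqP d3 /eqP d4].
move=> /and4P[/eqP b1 /eqP b2 /eqP b3 /eqP b4].
have AB : A *m B = A *m D.
  by rewrite -b3 -{1}d1 -mulmxA adjM b3 d3 mulmxA b1.
have BA : B *m A = D *m A.
  by rewrite -b4 -{1}d1 -mulmxA mulmxA adjM b4 d4 -mulmxA (mulmxA A) b1.
by rewrite -b2 BA -mulmxA AB mulmxA d2.
Qed.

End MoorePenrose.

Section DFT.
Variable R : realType.
Local Open Scope complex_scope.

Definition expC (z : R[i]) : R[i] :=
  let: a +i* b := z in (expR a)%:C * (cos b +i* sin b).

(* Indices start at 0 here, so [j * k] is (j - 1)(k - 1) for 1-based indices. *)
Definition dftmx (n : nat) : 'M[R[i]]_n :=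
  \matrix_(j < n, k < n)
    (expC (0 +i* (2 * pi * (j * k)%:R / n%:R)) / sqrtC n%:R).

End DFT.

(* Main.v *)
Require Import Defs.
From HB Require Import structures.
From mathcomp Require Import all_boot all_order all_algebra.
From mathcomp Require Import all_classical all_reals all_analysis.
From mathcomp Require Import complex.
From mathcomp Require Import ring lra.

Set Implicit Arguments.
Unset Strict Implicit.
Unset Printing Implicit Defensive.

Import Order.TTheory GRing.Theory Num.Theory.
Local Open Scope ring_scope.
Local Open Scope sesquilinear_scope.

(** The Fourier matrix diagonalizes every circulant matrix, and the Frobenius
    norm is unitarily invariant. In the Fourier basis the problem therefore
    splits into the independent one-row least squares problems of minimizing
    [|y_j - a_j x_j|] over the scalar [a_j]; each is solved by
    [a_j = y_j x_j^+], because [y_j - y_j x_j^+ x_j] is orthogonal to [x_j]. *)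

(** * Frobenius norm as a trace, and least squares by the pseudoinverse *)

Section LeastSquares.
Variable C : numClosedFieldType.
Implicit Types m n p : nat.

Lemma adjmxM m n p (A : 'M[C]_(m, n)) (B : 'M[C]_(n, p)) :
  (A *m B)^t* = B^t* *m A^t*.
Proof. by rewrite trmx_mul map_mxM. Qed.

Lemma adjmxD m n (A B : 'M[C]_(m, n)) : (A + B)^t* = A^t* + B^t*.
Proof. by rewrite linearD map_mxD. Qed.

Lemma frobenius_normE m n (A : 'M[C]_(m, n)) :
  frobenius_norm A = sqrtC (\tr (A *m A^t*)).
Proof.
rewrite /frobenius_norm; congr sqrtC; apply: eq_bigr => i _.
by rewrite mxE; apply: eq_bigr => j _; rewrite !mxE normCK.
Qed.

Lemma mxtrace_gram_ge0 m n (A : 'M[C]_(m, n)) : 0 <= \tr (A *m A^t*).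
Proof.
apply: sumr_ge0 => i _; rewrite mxE; apply: sumr_ge0 => j _.
by rewrite !mxE mul_conjC_ge0.
Qed.

Lemma frobenius_norm_le m n (A B : 'M[C]_(m, n)) :
  (frobenius_norm A <= frobenius_norm B) =
  (\tr (A *m A^t*) <= \tr (B *m B^t*)).
Proof. by rewrite !frobenius_normE ler_sqrtC // nnegrE mxtrace_gram_ge0. Qed.

Lemma mxtrace_gram_rows m n (A : 'M[C]_(m, n)) :
  \tr (A *m A^t*) = \sum_i \tr (row i A *m (row i A)^t*).
Proof.
apply: eq_bigr => i _; rewrite trace_mx11 !mxE.
by apply: eq_bigr => j _; rewrite !mxE.
Qed.

Lemma mxtrace_gram_pythagoras m n (A B : 'M[C]_(m, n)) :
  A *m B^t* = 0 ->
  \tr ((A + B) *m (A + B)^t*) = \tr (A *m A^t*) + \tr (B *m B^t*).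
Proof.
move=> AB0; have BA0 : B *m A^t* = 0.
  by rewrite -[B]trmxCK -adjmxM AB0 linear0 map_mx0.
by rewrite adjmxD mulmxDl !mulmxDr AB0 BA0 addr0 add0r mxtraceD.
Qed.

(** Any other residual differs from the optimal one by a matrix of the form [M *m X], to which the
    optimal residual is orthogonal; Pythagoras concludes. *)
Lemma mp_pinv_least_squares m n p (Y : 'M[C]_(m, n)) (X : 'M[C]_(p, n))
    (L : 'M[C]_(m, p)) :
  \tr ((Y - Y *m mp_pinv X *m X) *m (Y - Y *m mp_pinv X *m X)^t*)
    <= \tr ((Y - L *m X) *m (Y - L *m X)^t*).
Proof.
set E := Y - Y *m mp_pinv X *m X.
have /and4P[/eqP XPX _ _ /eqP PXH] := mp_pinvP X.
(* As [X^+ X] is Hermitian, [X^+ X X^*] is the adjoint of [X X^+ X = X]. *)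
have EX0 : E *m X^t* = 0.
  rewrite mulmxBl -(mulmxA Y) -[in X in _ - X]PXH -mulmxA -adjmxM.
  by rewrite mulmxA XPX subrr.
have -> : Y - L *m X = E + (Y *m mp_pinv X - L) *m X.
  by rewrite mulmxBl addrA subrK.
rewrite mxtrace_gram_pythagoras; last by rewrite adjmxM mulmxA EX0 mul0mx.
by rewrite lerDl mxtrace_gram_ge0.
Qed.

(** Since [x x^*] is the scalar [|x|^2], the right-hand side is a right inverse of [x]. This gives
    three Penrose equations; the fourth holds because the scalar is real. *)
Lemma mp_pinv_row n (x : 'rV[C]_n) :
  x != 0 -> mp_pinv x = (norm2 x ^+ 2)^-1 *: x^t*.
Proof.
have xxE : x *m x^t* = (norm2 x ^+ 2)%:M.
  apply/matrixP => i j; rewrite !ord1 !mxE eqxx mulr1n sqrtCK.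
  by apply: eq_bigr => k _; rewrite !mxE normCK.
have nE : norm2 x ^+ 2 = \sum_(j < n) `|x 0 j| ^+ 2 by rewrite sqrtCK.
move=> x0; have nx0 : norm2 x ^+ 2 != 0.
  apply: contra x0 => /eqP n0; apply/eqP/rowP => k; rewrite mxE.
  move: n0; rewrite nE => /eqP.
  rewrite psumr_eq0 => [/allP/(_ k)|l _]; last by rewrite exprn_ge0.
  by rewrite mem_index_enum sqrf_eq0 normr_eq0 => /(_ isT)/eqP.
have nR : ((norm2 x ^+ 2)^-1)^* = (norm2 x ^+ 2)^-1.
  apply/CrealP; rewrite rpredV nE; apply: rpred_sum => j _.
  by rewrite rpredX // normr_real.
have xB : x *m ((norm2 x ^+ 2)^-1 *: x^t*) = 1%:M.
  by rewrite -scalemxAr xxE scale_scalar_mx mulVf.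
apply/esym/mp_inverse_unique/and4P; split; apply/eqP.
- by rewrite xB mul1mx.
- by rewrite -mulmxA xB mulmx1.
- by rewrite xB trmx1 map_mx1.
- rewrite adjmxM linearZ /= map_mxZ trmxCK [X in X *: _]nR.
  by rewrite -scalemxAr -scalemxAl.
Qed.

End LeastSquares.

(** * Fourier matrix of a primitive root of unity, and circulant matrices *)

Section FourierMatrix.
Variables (C : numClosedFieldType) (n : nat) (w : C).
Hypothesis prim_w : n.-primitive_root w.

(** The root [w] is kept abstract, so that the arguments below are purely algebraic; [dftmxE]
    specializes it to [e^(2 pi i / n)]. *)
Definition fourier_mx : 'M[C]_n :=
  \matrix_(j < n, k < n) (w ^+ (j * k) / sqrtC n%:R).

Let n_gt0 : (0 < n)%N := prim_order_gt0 prim_w.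

Let w_neq0 : w != 0.
Proof.
apply: contra_eq_neq (prim_expr_order prim_w) => ->.
by rewrite expr0n gtn_eqF // eq_sym oner_neq0.
Qed.

Lemma conjC_prim_root : w^* = w^-1.
Proof.
have w1 : `|w| = 1.
  apply/eqP; rewrite -(@pexpr_eq1 _ _ n) ?normr_ge0 //.
  by rewrite -normrX (prim_expr_order prim_w) normr1.
by rewrite invC_norm w1 expr1n invr1 mul1r.
Qed.

Lemma sum_prim_root_quot (j k : 'I_n) :
  \sum_(l < n) w ^+ (j * l) * w^-1 ^+ (k * l) = n%:R * (j == k)%:R.
Proof.
have [->|jk] := eqVneq j k.
  under eq_bigr => l _ do rewrite exprVn divff ?expf_neq0 //.
  by rewrite sumr_const card_ord mulr1.
under eq_bigr => l _ do rewrite !exprM -exprMn.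
set z := w ^+ j * w^-1 ^+ k; rewrite mulr0; apply/eqP.
have z1 : z - 1 != 0.
  apply: contra jk; rewrite subr_eq0 /z exprVn => /eqP wjk.
  have /eqP : w ^+ j = w ^+ k.
    by rewrite -[LHS](divfK (expf_neq0 k w_neq0)) wjk mul1r.
  by rewrite (eq_prim_root_expr prim_w) !modn_small // => /eqP/val_inj ->.
(* Geometric sum: multiplied by [z - 1] it becomes [z^n - 1], which is 0. *)
rewrite -(mulrI_eq0 _ (mulfI z1)) -subrX1 /z exprMn !exprVn -!exprM.
by rewrite !(mulnC _ n) !exprM (prim_expr_order prim_w) !expr1n invr1 mulr1
           subrr.
Qed.

(** Exponents of [w] only matter modulo [n], so the circulant index separates into a factor in [j]
    and a factor in [k]. *)
Lemma expr_prim_root_sub (j k l : nat) : (k <= n)%N ->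
  w ^+ (l * ((j + (n - k)) %% n)) = w ^+ (l * j) * w^-1 ^+ (l * k).
Proof.
move=> kn; rewrite mulnC exprM (prim_expr_mod prim_w) -exprM.
apply: (mulIf (expf_neq0 (l * k) w_neq0)).
rewrite exprVn divfK ?expf_neq0 // -exprD (mulnC _ l) -mulnDr -addnA subnK //.
rewrite mulnDr exprD (mulnC l n) [w ^+ (n * l)]exprM.
by rewrite (prim_expr_order prim_w) expr1n mulr1.
Qed.

Lemma fourier_mx_adjE (j k : 'I_n) :
  fourier_mx^t* j k = w^-1 ^+ (j * k) / sqrtC n%:R.
Proof.
have sR : (sqrtC n%:R : C)^* = sqrtC n%:R.
  by apply/CrealP/ger0_real; rewrite sqrtC_ge0 ler0n.
by rewrite !mxE rmorphM rmorphXn fmorphV /= sR conjC_prim_root mulnC.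
Qed.

Lemma fourier_mx_unitary : fourier_mx \is unitarymx.
Proof.
have n_neq0 : n%:R != 0 :> C by rewrite pnatr_eq0 -lt0n.
apply/unitarymxP/matrixP => j k; rewrite mxE [RHS]mxE.
apply: (mulfI n_neq0); rewrite -sum_prim_root_quot mulr_sumr.
apply: eq_bigr => l _; rewrite fourier_mx_adjE mxE mulrACA -invfM -expr2 sqrtCK.
by rewrite mulrC divfK // (mulnC l k).
Qed.

Lemma fourier_mx_circulant (d : 'rV[C]_n) :
  circulant (fourier_mx *m diag_mx d *m fourier_mx^t*).
Proof.
(* The generating sequence is the inverse Fourier transform of [d]. *)
exists (fun t => \sum_(l < n) w ^+ (l * t) * (d 0 l / n%:R)) => j k.
rewrite mxE; apply: eq_bigr => l _.
rewrite mul_mx_diag fourier_mx_adjE !mxE (expr_prim_root_sub _ _ (ltnW _)) //.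
rewrite -[in RHS](sqrtCK n%:R) expr2 invfM (mulnC j l); ring.
Qed.

(** The columns of the Fourier matrix are eigenvectors of [B], with the Fourier transform of the
    generating sequence as eigenvalues. *)
Lemma circulant_fourier_mx (B : 'M[C]_n) :
  circulant B -> exists d, B *m fourier_mx = fourier_mx *m diag_mx d.
Proof.
case=> a Ba; exists (\row_q \sum_(t < n) a t * w^-1 ^+ (q * t)).
apply/matrixP => j q; rewrite mul_mx_diag !mxE mulr_sumr.
(* For fixed [j], the map sending [k] to [j - k] modulo [n] permutes the indices; it reindexes the
   eigenvalue sum. If two values agree, so do the powers [w^-k], hence the indices. *)
pose h (k : 'I_n) := Ordinal (ltn_pmod (j + (n - k)) n_gt0).
have h_inj : injective h.
  move=> k k' /(congr1 val)/= hkk; apply/val_inj.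
  have := @expr_prim_root_sub j k 1 (ltnW (ltn_ord k)).
  rewrite hkk expr_prim_root_sub ?(ltnW (ltn_ord k')) //.
  move=> /(mulfI (expf_neq0 _ w_neq0))/eqP.
  rewrite !exprVn (inj_eq invr_inj) (eq_prim_root_expr prim_w) !mul1n.
  by rewrite !modn_small // => /eqP.
rewrite [RHS](reindex_inj h_inj); apply: eq_bigr => k _.
rewrite Ba mxE /= exprVn (expr_prim_root_sub _ _ (ltnW _)) //.
rewrite exprVn invfM invrK (mulnC j q) (mulnC k q).
by rewrite [RHS]mulrCA mulrACA divff ?expf_neq0 // mul1r [_^-1 * _]mulrC.
Qed.

End FourierMatrix.

(** * Row-by-row splitting of the problem in a unitary basis *)

Section CirculantProcrustes.
Variables (C : numClosedFieldType) (n m : nat).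
Implicit Types (U : 'M[C]_n) (X Y : 'M[C]_(n, m)).

Lemma mxtrace_gram_unitary U Y :
  U \is unitarymx -> \tr (U^t* *m Y *m (U^t* *m Y)^t*) = \tr (Y *m Y^t*).
Proof.
move=> /unitarymxP UU; rewrite adjmxM trmxCK mxtrace_mulC -!mulmxA (mulmxA U).
by rewrite UU mul1mx mxtrace_mulC.
Qed.

Lemma diag_least_squares U X Y (d : 'rV[C]_n) :
  U \is unitarymx ->
  (forall j, d 0 j = (row j (U^t* *m Y) *m mp_pinv (row j (U^t* *m X))) 0 0) ->
  forall (B : 'M[C]_n) (e : 'rV[C]_n), B *m U = U *m diag_mx e ->
  frobenius_norm (Y - U *m diag_mx d *m U^t* *m X)
    <= frobenius_norm (Y - B *m X).
Proof.
move=> Uu dE B e BU; have UU := unitarymxP Uu.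
have U'U : U^t* *m U = 1%:M by exact: mulmx1C.
have -> : B = U *m diag_mx e *m U^t* by rewrite -BU -mulmxA UU mulmx1.
(* Row [j] of the residual, after multiplication by [U^*], for the diagonal [f]. *)
pose res (f : 'rV_n) j :=
  row j (U^t* *m Y) - (f 0 j)%:M *m row j (U^t* *m X).
have trE f : \tr ((Y - U *m diag_mx f *m U^t* *m X) *m
                  (Y - U *m diag_mx f *m U^t* *m X)^t*) =
    \sum_j \tr (res f j *m (res f j)^t*).
  rewrite -(mxtrace_gram_unitary _ Uu) mxtrace_gram_rows.
  apply: eq_bigr => j _.
  suff -> : row j (U^t* *m (Y - U *m diag_mx f *m U^t* *m X)) = res f j by [].
  rewrite /res mulmxBr !mulmxA U'U mul1mx linearB /= -mulmxA mul_scalar_mx.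
  by congr (_ - _); apply/rowP => k; rewrite mul_diag_mx !mxE.
rewrite frobenius_norm_le (trE d) (trE e); apply: ler_sum => j _.
have -> : res d j = row j (U^t* *m Y) -
    row j (U^t* *m Y) *m mp_pinv (row j (U^t* *m X)) *m row j (U^t* *m X).
  by rewrite /res dE -mx11_scalar.
exact: mp_pinv_least_squares.
Qed.

End CirculantProcrustes.

(** * The complex exponential as a primitive root of unity *)

Section DFT.
Variable R : realType.
Local Open Scope complex_scope.

Lemma expC_iM (x : R) k : expC (0 +i* x) ^+ k = expC (0 +i* (x *+ k)).
Proof.
rewrite /expC expR0 !mul1r; elim: k => [|k IH].
  by rewrite expr0 mulr0n cos0 sin0.
rewrite exprS IH mulrS cosD sinD; simpc.
by congr (_ +i* _); rewrite addrC mulrC [X in _ + X]mulrC.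
Qed.

Lemma expC_prim_root n : (0 < n)%N ->
  n.-primitive_root (expC (0 +i* (2 * pi / n%:R)) : R[i]).
Proof.
move=> n0; have nR0 : n%:R != 0 :> R by rewrite pnatr_eq0 -lt0n.
apply/andP; split=> //; apply/forallP => i; rewrite unity_rootE expC_iM.
rewrite /expC expR0 mul1r.
(* The angle is written as [2y]. If [i.+1 < n] then [0 < y < pi], so [sin y > 0], whereas
   [cos (2y) = 1] would force [sin y = 0]. *)
have xE : 2 * pi / n%:R *+ i.+1 = (pi * i.+1%:R / n%:R) *+ 2 :> R.
  by rewrite -[LHS]mulr_natr -[RHS]mulr_natr; ring.
have [iE|i_neq] := eqVneq i.+1 n.
  by rewrite xE iE mulfK // cos2pi sin2pi eqxx.
apply/eqP/negbTE/eqP => -[+ _]; rewrite xE.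
set y := pi * _ / _; rewrite cos_mulr2n => cy.
have : 0 < sin y.
  apply: sin_gt0_pi; rewrite /y divr_gt0 ?mulr_gt0 ?pi_gt0 ?ltr0n //=.
  rewrite ltr_pdivrMr ?ltr0n // ltr_pM2l ?pi_gt0 // ltr_nat.
  by rewrite ltn_neqAle i_neq ltn_ord.
have /eqP : sin y ^+ 2 = 0 by rewrite sin2cos2; lra.
by rewrite sqrf_eq0 => /eqP ->; rewrite ltxx.
Qed.

Lemma dftmxE n : dftmx R n = fourier_mx n (expC (0 +i* (2 * pi / n%:R))).
Proof.
apply/matrixP => j k; rewrite !mxE expC_iM; congr (expC (0 +i* _) / _).
by rewrite -[RHS]mulr_natr mulrAC.
Qed.

End DFT.

Theorem mainTheorem1 (R : realType) (n m : nat) (X Y : 'M[R[i]]_(n, m)) :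
  let F := dftmx R n in
  let Xhat := F^t* *m X in
  let Yhat := F^t* *m Y in
  let ahat := fun j : 'I_n => (row j Yhat *m mp_pinv (row j Xhat)) 0 0 in
  let A := F *m diag_mx (\row_j ahat j) *m F^t* in
  [/\ F \is unitarymx,
      circulant A,
      forall B : 'M[R[i]]_n, circulant B ->
        frobenius_norm (Y - A *m X) <= frobenius_norm (Y - B *m X) &
      forall j : 'I_n, row j Xhat != 0 ->
        ahat j = (row j Yhat *m (row j Xhat)^t*) 0 0
                 / norm2 (row j Xhat) ^+ 2].
Proof.
move=> F Xhat Yhat ahat A.
have aX j : row j Xhat != 0 -> ahat j =
    (row j Yhat *m (row j Xhat)^t*) 0 0 / norm2 (row j Xhat) ^+ 2.
  by move=> /mp_pinv_row xE; rewrite /ahat xE -scalemxAr mxE mulrC.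
(* There is no primitive root of order 0, so empty matrices are treated apart. *)
have [n0|n_gt0] := posnP n.
  move: X Y @F @Xhat @Yhat @ahat @A aX; rewrite n0 => X Y F Xhat Yhat ahat A aX.
  split=> //.
  - by apply/unitarymxP; rewrite [LHS]flatmx0 [RHS]flatmx0.
  - by exists (fun=> 0) => -[].
  - by move=> B _; rewrite (flatmx0 A) (flatmx0 B).
have prim_w := expC_prim_root R n_gt0.
have Fu : F \is unitarymx by rewrite /F dftmxE fourier_mx_unitary.
split; [exact: Fu | | | exact: aX].
  by rewrite /A /F dftmxE; exact: fourier_mx_circulant prim_w _.
move=> B /(circulant_fourier_mx prim_w)[e]; rewrite -dftmxE => BF.
by apply: diag_least_squares Fu _ _ _ BF => j; rewrite mxE.
Qed.
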